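(* Let $\lambda$ be a nonzero real number and $r$ a positive integer. For every integer $n\ge0$ (and every real $x$), the degenerate harmonic polynomial of order $r$ satisfies $$H_{n,\lambda}^{(r)}(x)=\sum_{k=r}^{n}\binom{x}{n-k}(-1)^{n-k}\sum_{l=r+1}^{k+1}\ \sum_{l_{1}+\cdots+l_{r+1}=l}\frac{(-\lambda)^{l-r-1}(1)_{l_{1},1/\lambda}\cdots(1)_{l_{r+1},1/\lambda}}{l_{1}!\cdots l_{r+1}!}\qquad\text{if } n\ge r,$$ and $H_{n,\lambda}^{(r)}(x)=0$ if $n<r$. Here the innermost sum is over all $(r+1)$-tuples of positive integers $(l_1,\dots,l_{r+1})$ with $l_1+\cdots+l_{r+1}=l$.
   Context: All generating functions are formal power series in $t$ with real coefficients. For real $\mu$ and $x$: $(x)_{0,\mu}=1$, $(x)_{k,\mu}=x(x-\mu)\cdots(x-(k-1)\mu)$ for $k\ge1$; thus $(1)_{k,1/\lambda}=\prod_{j=0}^{k-1}(1-j/\lambda)$. For real $x$, $\binom{x}{m}=\frac{x(x-1)\cdots(x-m+1)}{m!}$ is the generalized binomial coefficient. The degenerate logarithm is $\log_\lambda(1+t)=\frac{1}{\lambda}\left((1+t)^\lambda-1\right)$. The degenerate harmonic polynomials of order $r$ are defined by $\sum_{n\ge0}H_{n,\lambda}^{(r)}(x)t^n=\frac{\left(-\log_\lambda(1-t)\right)^{r+1}}{t(1-t)}(1-t)^x$. *)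

(* Defs.v *)
From HB Require Import structures.
From mathcomp Require Import all_boot all_order all_algebra.
From mathcomp Require Import boolp classical_sets functions reals.

Set Implicit Arguments.
Unset Strict Implicit.
Unset Printing Implicit Defensive.

Import Order.TTheory GRing.Theory Num.Theory.
Local Open Scope ring_scope.

(* A formal power series is its coefficient sequence. The alias keeps the     *)
(* pointwise module structure of functions but carries the Cauchy product     *)
(* instead of the pointwise one.                                              *)
Definition fps (R : comNzRingType) : Type := nat -> R.

HB.instance Definition _ (R : comNzRingType) := Choice.copy (fps R) (nat -> R).
HB.instance Definition _ (R : comNzRingType) :=
  GRing.Lmodule.copy (fps R) (nat -> R^o).

Section FpsRing.
Variable R : comNzRingType.
Implicit Types f g h : fps R.

Definition fps_one : fps R := fun n => (n == 0%N)%:R.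

Definition fps_mul f g : fps R := fun n => \sum_(i < n.+1) f i * g (n - i)%N.

Lemma fps_mul_poly f g (m n : nat) : (n < m)%N ->
  fps_mul f g n = ((\poly_(i < m) f i) * (\poly_(i < m) g i))`_n.
Proof.
move=> nm; rewrite coefM; apply: eq_bigr => i _; rewrite !coef_poly.
have -> : (i < m)%N by apply: leq_ltn_trans nm; rewrite -ltnS.
by have -> : (n - i < m)%N by apply: leq_ltn_trans nm; apply: leq_subr.
Qed.

Lemma fps_mulA : associative fps_mul.
Proof.
move=> f g h; apply: funext => n.
pose P u := \poly_(i < n.+1) (u : fps R) i.
transitivity (P f * (P g * P h))`_n.
  rewrite coefM; apply: eq_bigr => i _.
  rewrite coef_poly ltn_ord -(@fps_mul_poly g h n.+1) //.
  by rewrite ltnS leq_subr.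
rewrite mulrA coefM; apply: eq_bigr => i _.
by rewrite coef_poly ltnS leq_subr -(@fps_mul_poly f g n.+1).
Qed.

Lemma fps_mulC : commutative fps_mul.
Proof.
by move=> f g; apply: funext => n; rewrite !(@fps_mul_poly _ _ n.+1) // mulrC.
Qed.

Lemma fps_mul1 : left_id fps_one fps_mul.
Proof.
move=> f; apply: funext => n; rewrite /fps_mul big_ord_recl /fps_one /= mul1r.
by rewrite subn0 big1 ?addr0 // => i _; rewrite mul0r.
Qed.

Lemma fps_mulDl : left_distributive fps_mul +%R.
Proof.
move=> f g h; apply: funext => n.
change (fps_mul (f + g) h n = fps_mul f h n + fps_mul g h n).
rewrite /fps_mul -big_split /=.
by apply: eq_bigr => i _; rewrite -mulrDl.
Qed.

Lemma fps_one_neq0 : fps_one != 0 :> fps R.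
Proof.
apply/eqP => /(congr1 (fun f => (f : nat -> R) 0%N)) /eqP.
by rewrite /fps_one eqxx (oner_eq0 R).
Qed.

HB.instance Definition _ := GRing.Zmodule_isComNzRing.Build (fps R)
  fps_mulA fps_mulC fps_mul1 fps_mulDl fps_one_neq0.

(* the variable t *)
Definition fps_X : fps R := fun n => (n == 1%N)%:R.

(* f(c t) *)
Definition fps_scale_var (c : R) f : fps R := fun n => c ^+ n * f n.

(* The quotient f / g: the series h with g h = f (0 when there is none). For  *)
(* g = t (1 - t), which is not a zero divisor, h is unique, and it exists as  *)
(* soon as f has zero constant term (fps_div_X1X).                            *)
Definition fps_div f g : fps R := xget 0 [set h | g * h = f]%classic.

Lemma fps_mulXE f n : (fps_X * f) n = if n is m.+1 then f m else 0.
Proof.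
rewrite /GRing.mul /= /fps_mul /fps_X; case: n => [|n].
  by rewrite big_ord_recl big_ord0 /= mul0r addr0.
rewrite big_ord_recl mul0r add0r big_ord_recl /= mul1r subSS subn0.
by rewrite big1 ?addr0 // => i _; rewrite mul0r.
Qed.

Lemma fps_div_X1X f : f 0%N = 0 ->
  fps_X * (1 - fps_X) * fps_div f (fps_X * (1 - fps_X)) = f.
Proof.
move=> f0; rewrite /fps_div.
apply: (xgetPex 0 (P := [set h | fps_X * (1 - fps_X) * h = f]%classic)).
pose h : fps R := fun n => \sum_(i < n.+1) f i.+1.
exists h => /=; rewrite -mulrA mulrBl mul1r; apply: funext => -[|n].
  by rewrite fps_mulXE f0.
rewrite fps_mulXE; change (h n - (fps_X * h) n = f n.+1).
rewrite fps_mulXE /h; case: n => [|n]; first by rewrite subr0 big_ord1.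
by rewrite [X in X - _]big_ord_recr /= addrAC subrr add0r.
Qed.

End FpsRing.

Section DegenerateHarmonic.
Variable R : realType.
Implicit Types lambda mu x : R.

(* (x)_{k,mu} *)
Definition degenerate_ffact mu x (k : nat) : R := \prod_(j < k) (x - j%:R * mu).

Definition gbinom x (m : nat) : R := (\prod_(j < m) (x - j%:R)) / m`!%:R.

(* (1 + t)^x, for a real exponent x *)
Definition fps_1Xpow x : fps R := gbinom x.

(* log_lambda(1 + t) *)
Definition degenerate_log lambda : fps R :=
  lambda^-1 *: (fps_1Xpow lambda - 1).

(* (- log_lambda(1 - t))^(r + 1) *)
Definition degenerate_harmonic_num lambda (r : nat) : fps R :=
  (- fps_scale_var (-1) (degenerate_log lambda)) ^+ r.+1.

Definition degenerate_harmonic_gf lambda (r : nat) x : fps R :=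
  fps_div (degenerate_harmonic_num lambda r) (fps_X R * (1 - fps_X R))
  * fps_scale_var (-1) (fps_1Xpow x).

(* H_{n,lambda}^{(r)}(x) *)
Definition degenerate_harmonic lambda (r n : nat) x : R :=
  degenerate_harmonic_gf lambda r x n.

Lemma degenerate_harmonic_num0 lambda r : degenerate_harmonic_num lambda r 0%N = 0.
Proof.
rewrite /degenerate_harmonic_num exprS.
set f := - _; suff f0 : f 0%N = 0.
  by rewrite /GRing.mul /= /fps_mul big_ord_recl big_ord0 f0 mul0r addr0.
change (- (1 * (lambda^-1 * (gbinom lambda 0 - 1))) = 0 :> R).
by rewrite /gbinom big_ord0 divr1 subrr !mulr0 oppr0.
Qed.

Lemma degenerate_harmonic_divP lambda r x :
  fps_X R * (1 - fps_X R) * degenerate_harmonic_gf lambda r x =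
  degenerate_harmonic_num lambda r * fps_scale_var (-1) (fps_1Xpow x).
Proof. by rewrite mulrA fps_div_X1X // degenerate_harmonic_num0. Qed.

End DegenerateHarmonic.

(* Main.v *)
Require Import Defs.
From HB Require Import structures.
From mathcomp Require Import all_boot all_order all_algebra.
From mathcomp Require Import boolp classical_sets functions reals.

Set Implicit Arguments.
Unset Strict Implicit.
Unset Printing Implicit Defensive.

Import Order.TTheory GRing.Theory Num.Theory.
Local Open Scope ring_scope.

(** The factor [- log_lambda (1 - t)] has no constant term, and its coefficient
    at [t^m] for [m > 0] is [(- lambda) ^ (m - 1) (1)_{m,1/lambda} / m!], so its
    [(r + 1)]-st power is the sum over compositions into [r + 1] parts. Dividing
    by [t (1 - t)] shifts the index and takes partial sums, and the factor
    [(1 - t) ^ x] contributes the outer convolution. *)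

Section FpsCoefficients.
Variable R : comNzRingType.
Implicit Type f : fps R.

(** A coefficient of a Cauchy product involves only entries of index at most its own, so truncating
    at [N] is harmless. The truncation is a finite sum of monomials, whose power can be expanded by
    distributivity. *)
Lemma fps_expr_poly f (m N n : nat) : (n < N)%N ->
  (f ^+ m : fps R) n = ((\poly_(i < N) f i) ^+ m)`_n.
Proof.
elim: m n => [|m IH] n nN; first by rewrite !expr0 coef1.
rewrite !exprS coefM; apply: eq_bigr => i _.
rewrite coef_poly -IH; last exact: leq_ltn_trans (leq_subr _ _) nN.
by rewrite (leq_ltn_trans _ nN) // -ltnS.
Qed.

Lemma fps_expr_coef f (m n : nat) : (f ^+ m : fps R) n =
  \sum_(s : {ffun 'I_m -> 'I_n.+1} | (\sum_i s i == n)%N) \prod_i f (s i).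
Proof.
(* Writing the exponent as the cardinal of ['I_m] turns the power into a product over ['I_m] of
   sums; distributing it gives one monomial per choice [s] of exponents. *)
rewrite (@fps_expr_poly _ _ n.+1) // poly_def -[m in X in X`_n]card_ord.
rewrite -prodr_const bigA_distr_bigA coef_sum [RHS]big_mkcond /=.
apply: eq_bigr => s _.
have -> : \prod_i (f (s i) *: 'X^(s i) : {poly R}) =
    (\prod_i f (s i)) *: 'X^(\sum_i s i).
  by rewrite scaler_prod expr_sum.
rewrite coefZ coefXn eq_sym.
by case: eqP => _; rewrite ?mulr1 ?mulr0.
Qed.

Lemma fps_expr_coef0 f (m n : nat) : f 0%N = 0 -> (f ^+ m : fps R) n =
  \sum_(s : {ffun 'I_m -> 'I_n.+1} |
         [forall i, (0 < s i)%N] && (\sum_i s i == n)%N) \prod_i f (s i).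
Proof.
move=> f0; pose pos (s : {ffun 'I_m -> 'I_n.+1}) := [forall i, (0 < s i)%N].
rewrite fps_expr_coef (bigID pos) /=.
rewrite [X in _ + X]big1 ?addr0; first by apply: eq_bigl => s; rewrite andbC.
move=> s /andP[_ /forallPn[i]]; rewrite -eqn0Ngt => /eqP si.
by rewrite (bigD1 i) //= si f0 mul0r.
Qed.

(** There is no composition to sum over: [m] positive parts add up to at least [m]. *)
Lemma fps_expr_coef_lt f (m n : nat) : f 0%N = 0 -> (n < m)%N ->
  (f ^+ m : fps R) n = 0.
Proof.
move=> f0 nm; rewrite fps_expr_coef0 // big_pred0 // => s.
apply/negP => /andP[/forallP s_gt0 /eqP sn].
have : (\sum_(i < m) 1 <= \sum_i s i)%N by apply: leq_sum => i _; apply: s_gt0.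
by rewrite sum1_card card_ord sn leqNgt nm.
Qed.

(** Comparing coefficients in [X (1 - X) h = f] gives [h n - h (n - 1) = f (n + 1)], which
    telescopes. *)
Lemma fps_div_X1X_coef f (k : nat) : f 0%N = 0 ->
  fps_div f (fps_X R * (1 - fps_X R)) k = \sum_(i < k.+1) f i.+1.
Proof.
move=> f0; set h := fps_div _ _.
have hE n : h n - (if n is m.+1 then h m else 0) = f n.+1.
  rewrite -(fps_div_X1X f0) -/h -mulrA mulrBl mul1r fps_mulXE.
  change (h n - (if n is m.+1 then h m else 0) = h n - (fps_X R * h) n).
  by rewrite fps_mulXE.
elim: k => [|k IH]; first by rewrite big_ord1 -hE subr0.
by rewrite big_ord_recr /= -IH -hE addrC subrK.
Qed.

End FpsCoefficients.

Section DegenerateLogCoefficients.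
Variables (R : realType) (lambda : R).
Hypothesis lambda_neq0 : lambda != 0.

Let f : fps R := - fps_scale_var (-1) (degenerate_log lambda).

Lemma degenerate_log_opp_coef0 : f 0%N = 0.
Proof.
change (- (1 * (lambda^-1 * (gbinom lambda 0 - 1))) = 0 :> R).
by rewrite /gbinom big_ord0 divr1 subrr !mulr0 oppr0.
Qed.

(** Each factor splits as [lambda - j = lambda (1 - j / lambda)]. *)
Lemma gbinom_degenerate_ffact (m : nat) :
  gbinom lambda m = lambda ^+ m * degenerate_ffact (1 / lambda) 1 m / m`!%:R.
Proof.
have -> : lambda ^+ m = \prod_(j < m) lambda by rewrite prodr_const card_ord.
rewrite /gbinom /degenerate_ffact -big_split /=.
congr (_ / _); apply: eq_bigr => j _.
by rewrite mulrBr mulr1 mul1r mulrCA divff // mulr1.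
Qed.

Lemma degenerate_log_opp_coef (m : nat) : (0 < m)%N ->
  f m = (- lambda) ^+ m.-1 * degenerate_ffact (1 / lambda) 1 m / m`!%:R.
Proof.
case: m => // m _ /=.
(* The [0] is the coefficient of the series [1] in positive degree. *)
change (- ((-1) ^+ m.+1 * (lambda^-1 * (gbinom lambda m.+1 - 0))) =
  (- lambda) ^+ m * degenerate_ffact (1 / lambda) 1 m.+1 / m.+1`!%:R).
rewrite subr0 gbinom_degenerate_ffact !exprS mulN1r mulNr opprK.
by rewrite [(- lambda) ^+ m]exprNn !mulrA -[_ * lambda^-1 * lambda]mulrA
  mulVf // mulr1.
Qed.

Lemma degenerate_harmonic_num_coef (r l : nat) :
  degenerate_harmonic_num lambda r l =
  \sum_(s : {ffun 'I_r.+1 -> 'I_l.+1} |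
         [forall i, (0 < s i)%N] && (\sum_i s i == l)%N)
    (- lambda) ^+ (l - r.+1) *
    (\prod_i degenerate_ffact (1 / lambda) 1 (s i)) /
    (\prod_i (s i)`!%:R).
Proof.
rewrite /degenerate_harmonic_num fps_expr_coef0; last first.
  exact: degenerate_log_opp_coef0.
apply: eq_bigr => s /andP[/forallP s_gt0 /eqP sl].
rewrite (eq_bigr _ (fun i _ => degenerate_log_opp_coef (s_gt0 i))).
rewrite !big_split /= prodfV -expr_sum; congr (_ ^+ _ * _ / _).
(* The exponents of [- lambda] add up to [l - r.+1]: each of the [r.+1] positive parts loses one. *)
suff : l = (\sum_i (s i).-1 + r.+1)%N.
  by move=> /(congr1 (subn^~ r.+1)); rewrite /= addnK.
rewrite -[X in (_ + X)%N](card_ord r.+1) -sum1_card -big_split /= -[LHS]sl.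
by apply: eq_bigr => i _; rewrite addn1 prednK.
Qed.

End DegenerateLogCoefficients.

Theorem mainTheorem7 (R : realType) (lambda : R) (r : nat)
    (lambda_neq0 : lambda != 0) (r_gt0 : (0 < r)%N) (n : nat) (x : R) :
  ((r <= n)%N ->
    degenerate_harmonic lambda r n x =
    \sum_(r <= k < n.+1) gbinom x (n - k) * (-1) ^+ (n - k) *
      \sum_(r.+1 <= l < k.+2)
        \sum_(s : {ffun 'I_r.+1 -> 'I_l.+1} |
               [forall i, (0 < s i)%N] && (\sum_i s i == l)%N)
          (- lambda) ^+ (l - r.+1) *
          (\prod_i degenerate_ffact (1 / lambda) 1 (s i)) /
          (\prod_i (s i)`!%:R)) /\
  ((n < r)%N -> degenerate_harmonic lambda r n x = 0).
Proof.
have num_lt l : (l < r.+1)%N -> degenerate_harmonic_num lambda r l = 0.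
  by apply: fps_expr_coef_lt; apply: degenerate_log_opp_coef0.
pose q : fps R :=
  fps_div (degenerate_harmonic_num lambda r) (fps_X R * (1 - fps_X R)).
(* The index is shifted to start at the vanishing term [l = 0], so that the sum can later be cut at
   [r.+1]. *)
have qE k : q k = \sum_(0 <= l < k.+2) degenerate_harmonic_num lambda r l.
  rewrite [q k]fps_div_X1X_coef ?num_lt //.
  by rewrite big_nat_recl // num_lt // add0r big_mkord.
have q_lt k : (k < r)%N -> q k = 0.
  move=> kr; rewrite qE big_nat big1 // => l /andP[_ lk].
  by rewrite num_lt // (leq_trans lk).
have HE : degenerate_harmonic lambda r n x =
    \sum_(0 <= k < n.+1) q k * ((-1) ^+ (n - k) * gbinom x (n - k)).
  by rewrite big_mkord.
split=> [rn|nr]; rewrite HE; last first.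
  rewrite big_nat big1 // => k /andP[_ kn].
  by rewrite q_lt ?mul0r // (leq_ltn_trans _ nr) // -ltnS.
rewrite (@big_cat_nat _ _ _ r) //=; last exact: leqW.
rewrite [X in X + _]big_nat big1 ?add0r; last first.
  by move=> k /andP[_ kr]; rewrite q_lt ?mul0r.
(* The bound [r <= k] is kept because cutting the inner sum at [r.+1] requires [r.+1 <= k.+2]. *)
rewrite big_nat [RHS]big_nat; apply: eq_bigr => k /andP[rk _].
rewrite mulrC [_ * gbinom _ _]mulrC qE; congr (_ * _).
rewrite (@big_cat_nat _ _ _ r.+1) //=; last by rewrite ltnS leqW.
rewrite [X in X + _]big_nat big1 ?add0r; last first.
  by move=> l /andP[_ lr]; apply: num_lt.
by apply: eq_bigr => l _; apply: degenerate_harmonic_num_coef.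
Qed.
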